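(* Let $\alpha$ be a positive measure on $\mathbf{R}$ with infinite support and finite moments of all orders $s_n=\int_{\mathbf{R}} x^n\,d\alpha(x)$, $n\ge 0$, and suppose that the moment problem associated with $(s_n)_{n\ge 0}$ is indeterminate. Let $(p_k)_{k\ge 0}$ be the orthonormal polynomials with respect to $\alpha$, and for $\theta\in[0,2\pi]$ put $$\rho(e^{i\theta})=\left(\sum_{k=0}^{\infty}\left|p_k(e^{i\theta})\right|^2\right)^{-1}.$$ For $N\ge 0$ let $\lambda_N$ be the smallest eigenvalue of the $(N+1)\times(N+1)$ Hankel matrix $\mathcal{H}_N=(s_{j+k})_{0\le j,k\le N}$. Then $\lambda_N$ is bounded below by the harmonic mean of $\rho$ along the unit circle, i.e. for every $N\ge 0$, $$\lambda_N\;\ge\;\left(\int_0^{2\pi}\frac{1}{\rho(e^{i\theta})}\,\frac{d\theta}{2\pi}\right)^{-1}.$$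
   Context: The moment problem is the Hamburger moment problem (on the whole real line). It is called determinate if $\alpha$ is the only positive measure on $\mathbf{R}$ having the moments $(s_n)_{n\ge 0}$, and indeterminate otherwise. The orthonormal polynomials $p_k$ are the real polynomials with $\deg p_k=k$, positive leading coefficient, and $\int_{\mathbf{R}} p_j p_k\,d\alpha=\delta_{jk}$. In the indeterminate case it is a classical fact that $\sum_{k=0}^\infty |p_k(z)|^2$ converges for all $z\in\mathbf{C}$, uniformly on compact sets, so $\rho$ is well defined on the unit circle. *)

(* Defs.v *)
From HB Require Import structures.
From mathcomp Require Import all_boot all_order all_algebra.
From mathcomp Require Import all_classical all_reals all_analysis.
From mathcomp Require Import complex.

Set Implicit Arguments.
Unset Strict Implicit.
Unset Printing Implicit Defensive.

Import Order.TTheory GRing.Theory Num.Theory.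
Import numFieldNormedType.Exports.

Local Open Scope classical_set_scope.
Local Open Scope ring_scope.

(* A positive Borel measure on the real line; its values outside the Borel
   sets carry no information. *)
Definition borel_measure (R : realType) :=
  {measure set (measurableTypeR R) -> \bar R}.

Definition measure_support (R : realType) (mu : borel_measure R) : set R :=
  [set x | forall U : set R, open U -> U x -> (0 < mu U)%E].

Definition finite_moments (R : realType) (mu : borel_measure R) : Prop :=
  forall n : nat, mu.-integrable setT (fun x : R => (x ^+ n)%:E).

Definition moment (R : realType) (mu : borel_measure R) (n : nat) : R :=
  \int[mu]_(x in setT) (x ^+ n).

Definition has_moments (R : realType) (mu : borel_measure R) (s : nat -> R) :
    Prop :=
  finite_moments mu /\ forall n : nat, moment mu n = s n.

(* Determinacy compares measures on Borel sets only, as two set functions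
   agreeing there may still differ elsewhere. *)
Definition determinate (R : realType) (mu : borel_measure R) : Prop :=
  forall nu : borel_measure R, has_moments nu (moment mu) ->
  forall A : set (measurableTypeR R), measurable A -> nu A = mu A.

Definition indeterminate (R : realType) (mu : borel_measure R) : Prop :=
  ~ determinate mu.

Definition orthonormal_polynomials (R : realType) (mu : borel_measure R)
    (p : nat -> {poly R}) : Prop :=
  [/\ forall k : nat, size (p k) = k.+1,
      forall k : nat, 0 < lead_coef (p k) &
      forall j k : nat,
        \int[mu]_(x in setT) ((p j).[x] * (p k).[x]) = (j == k)%:R].

Definition hankel (R : realType) (s : nat -> R) (N : nat) : 'M[R]_N.+1 :=
  \matrix_(j, k) s (j + k)%N.

Definition smallest_eigenvalue (R : realType) (n : nat) (A : 'M[R]_n) (a : R) :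
    Prop :=
  eigenvalue A a /\ forall b : R, eigenvalue A b -> a <= b.

Definition expi (R : realType) (t : R) : R[i] := Complex (cos t) (sin t).

Definition cpoly_eval (R : realType) (q : {poly R}) (z : R[i]) : R[i] :=
  (map_poly (real_complex R) q).[z].

(* The series of nonnegative terms and its inverse are taken in the extended
   reals, where [+oo^-1 = 0], so [rho] is total; the sum is finite, and [rho p z]
   a positive real, when the moment problem is indeterminate. *)
Definition rho (R : realType) (p : nat -> {poly R}) (z : R[i]) : \bar R :=
  ((\sum_(0 <= k <oo)
      (ComplexField.Normc.normc (cpoly_eval (p k) z) ^+ 2)%:E)^-1)%E.

Definition circle_harmonic_mean (R : realType) (f : R[i] -> \bar R) : \bar R :=
  ((\int[lebesgue_measure]_(t in `[0%R, (2 * pi)%R])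
      ((f (expi t))^-1 * ((2 * pi)^-1)%:E))^-1)%E.

(* Main.v *)
Require Import Defs.
From mathcomp Require Import all_boot all_order all_algebra.
From mathcomp Require Import all_classical all_reals all_analysis.
From mathcomp Require Import measurable_realfun complex ring.

Import Order.TTheory GRing.Theory Num.Theory.
Import numFieldNormedType.Exports.

Local Open Scope classical_set_scope.
Local Open Scope ring_scope.

(** Let [v] be an eigenvector of the Hankel matrix for [lambda] and [q] the
    polynomial of degree at most [N] with coefficients [v].  The quadratic form
    of the Hankel matrix is the square integral against [alpha], so

      lambda * sum_i v_i^2 = int q^2 dalpha = sum_j c_j^2,

    where [q = sum_j c_j p_j] is the expansion of [q] in the orthonormal
    polynomials ([hankel_form], [poly_span], [orthonormal_sqr_integral]).  On
    the other hand the monomials are orthonormal on the unit circle for the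
    normalized arc length ([integral_normc_cpoly]), and Cauchy-Schwarz bounds
    [q] at each point of the circle, so

      sum_i v_i^2 = int |q|^2 dt/(2 pi)
                 <= (sum_j c_j^2) * int sum_k |p_k|^2 dt/(2 pi),

    the last integral being that of [1 / rho] ([coef_sqr_le]).  Combining the
    two lines and dividing by [sum_i v_i^2 > 0] gives
    [1 <= lambda * int (1 / rho) dt/(2 pi)].  All integrands are nonnegative, so
    this is meaningful in the extended reals: if the integral is infinite, the
    harmonic mean is [0] and the bound says that [lambda] is nonnegative. *)

(** * Expansion in a graded family of polynomials *)

(** Induction on the size bound: subtracting the multiple of [p n] that cancels
    the coefficient of degree [n] lowers the bound by one. *)
Lemma poly_span (F : fieldType) (p : nat -> {poly F})
    (size_p : forall k, size (p k) = k.+1) (n : nat) (q : {poly F}) :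
  (size q <= n)%N -> exists c : nat -> F, q = \sum_(i < n) c i *: p i.
Proof.
elim: n q => [|n IHn] q sq.
  by exists (fun=> 0); rewrite big_ord0; apply/eqP; rewrite -size_poly_leq0.
have lead_neq0 : (p n)`_n != 0.
  by rewrite -[X in _`_X]/(n.+1.-1) -size_p -lead_coefE lead_coef_eq0
             -size_poly_eq0 size_p.
pose a := q`_n / (p n)`_n.
have [|c qE] := IHn (q - a *: p n).
  apply/leq_sizeP => k; rewrite leq_eqVlt coefB coefZ => /predU1P[<-|nk].
    by rewrite divfK ?subrr.
  by rewrite !nth_default ?mulr0 ?subr0 ?size_p // (leq_trans sq).
exists (fun i => if i == n then a else c i).
rewrite big_ord_recr /= eqxx -[LHS](subrK (a *: p n)) qE; congr (_ + _).
by apply: eq_bigr => i _; rewrite ltn_eqF.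
Qed.

(** * The Cauchy-Schwarz inequality for real combinations of complex numbers *)

(** By Lagrange's identity, twice the defect is the sum over all pairs of the
    squares [(a i * b j - a j * b i) ^+ 2]. *)
Lemma cauchy_schwarz_sum (R : realDomainType) (n : nat) (a b : 'I_n -> R) :
  (\sum_i a i * b i) ^+ 2 <= (\sum_i a i ^+ 2) * (\sum_i b i ^+ 2).
Proof.
have lagrange : \sum_i \sum_j (a i * b j - a j * b i) ^+ 2 =
    ((\sum_i a i ^+ 2) * (\sum_i b i ^+ 2) - (\sum_i a i * b i) ^+ 2) *+ 2.
  rewrite expr2 mulrnBl !mulr2n !mulr_suml.
  rewrite [X in _ = _ + X - _](_ : _ = \sum_i \sum_j a j ^+ 2 * b i ^+ 2).
    rewrite -!big_split -sumrB; apply: eq_bigr => i _ /=.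
    rewrite !mulr_sumr -!big_split -sumrB; apply: eq_bigr => j _ /=.
    ring.
  rewrite exchange_big; apply: eq_bigr => i _; exact: mulr_sumr.
rewrite -subr_ge0 -(pmulrn_lge0 _ (ltn0Sn 1)) -lagrange.
by apply: sumr_ge0 => i _; apply: sumr_ge0 => j _; exact: sqr_ge0.
Qed.

Lemma normc_sqr (R : rcfType) (z : R[i]) :
  ComplexField.Normc.normc z ^+ 2 = complex.Re z ^+ 2 + complex.Im z ^+ 2.
Proof. by case: z => a b /=; rewrite sqr_sqrtr // addr_ge0 // sqr_ge0. Qed.

Lemma cpoly_eval_sum (R : realType) (n : nat) (c : nat -> R)
    (p : nat -> {poly R}) (z : R[i]) :
  cpoly_eval (\sum_(i < n) c i *: p i) z =
  \sum_(i < n) real_complex R (c i) * cpoly_eval (p i) z.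
Proof.
rewrite /cpoly_eval rmorph_sum horner_sum; apply: eq_bigr => i _ /=.
by rewrite map_polyZ hornerZ.
Qed.

Lemma Re_sum_scale (R : rcfType) (n : nat) (c : 'I_n -> R) (w : 'I_n -> R[i]) :
  complex.Re (\sum_i real_complex R (c i) * w i) = \sum_i c i * complex.Re (w i).
Proof.
rewrite raddf_sum; apply: eq_bigr => i _.
by case: (w i) => x y /=; rewrite mul0r subr0.
Qed.

Lemma Im_sum_scale (R : rcfType) (n : nat) (c : 'I_n -> R) (w : 'I_n -> R[i]) :
  complex.Im (\sum_i real_complex R (c i) * w i) = \sum_i c i * complex.Im (w i).
Proof.
rewrite raddf_sum; apply: eq_bigr => i _.
by case: (w i) => x y /=; rewrite mul0r addr0.
Qed.

(** As the scalars are real, this is the real inequality for the real parts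
    plus the one for the imaginary parts. *)
Lemma normc_sum_scale_le (R : rcfType) (n : nat) (c : 'I_n -> R)
    (w : 'I_n -> R[i]) :
  ComplexField.Normc.normc (\sum_i real_complex R (c i) * w i) ^+ 2 <=
  (\sum_i c i ^+ 2) * \sum_i ComplexField.Normc.normc (w i) ^+ 2.
Proof.
rewrite normc_sqr Re_sum_scale Im_sum_scale.
rewrite (eq_bigr _ (fun i _ => normc_sqr _ (w i))) big_split mulrDr.
by apply: lerD; exact: cauchy_schwarz_sum.
Qed.

(** * Orthonormality of the monomials on the unit circle *)

(** De Moivre's formula. *)
Lemma expiX (R : realType) (t : R) (n : nat) :
  expi t ^+ n = Complex (cos (n%:R * t)) (sin (n%:R * t)).
Proof.
elim: n => [|n IHn]; first by rewrite expr0 mul0r cos0 sin0.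
rewrite exprS IHn /expi -[n.+1]add1n natrD mulrDl mul1r cosD sinD.
by apply/eqP; rewrite eq_complex /= eqxx addrC eqxx.
Qed.

(** Writing the square modulus as a trigonometric polynomial makes both its
    continuity and its primitive explicit. *)
Lemma normc_cpoly_eval_expi (R : realType) (n : nat) (q : {poly R}) (t : R) :
  (size q <= n)%N ->
  ComplexField.Normc.normc (cpoly_eval q (expi t)) ^+ 2 =
  \sum_(i < n) \sum_(j < n) q`_i * q`_j * cos ((i%:R - j%:R) * t).
Proof.
move=> sq; rewrite /cpoly_eval (@horner_coef_wide _ n) ?size_map_poly //.
under eq_bigr => i _ do rewrite coef_map expiX.
rewrite normc_sqr Re_sum_scale Im_sum_scale /= !expr2 !mulr_suml -big_split.
apply: eq_bigr => i _ /=; rewrite !mulr_sumr -big_split.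
apply: eq_bigr => j _ /=; rewrite mulrBl cosB; ring.
Qed.

Lemma continuous_normc_cpoly (R : realType) (q : {poly R}) :
  continuous (fun t : R => ComplexField.Normc.normc (cpoly_eval q (expi t)) ^+ 2).
Proof.
under eq_fun do rewrite (@normc_cpoly_eval_expi _ (size q)) //.
apply: continuous_big => [|i _]; first exact: add_continuous.
apply: continuous_big => [|j _ t]; first exact: add_continuous.
apply: cvgMl_tmp.
apply: (@continuous_comp _ _ _ (fun t : R => (i%:R - j%:R) * t) (@cos R)).
  by apply: cvgMl_tmp; exact: cvg_id.
exact: continuous_cos.
Qed.

Lemma sin_2pi_nat (R : realType) (m : nat) : sin (m%:R * (2 * pi)) = 0 :> R.
Proof.
have -> : m%:R * (2 * pi) = 0 + (pi *+ 2) *+ m :> R.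
  by rewrite add0r !mulr_natl.
exact: etrans (periodicn (@sinD2pi R) m 0) (sin0 R).
Qed.

Lemma sin_2pi_int (R : realType) (i j : nat) :
  sin ((i%:R - j%:R) * (2 * pi)) = 0 :> R.
Proof. by rewrite mulrBl sinB !sin_2pi_nat mul0r mulr0 subr0. Qed.

(** Parseval's identity: in the trigonometric polynomial the off-diagonal terms
    have a [2 pi]-periodic primitive, so that only the diagonal contributes. *)
Lemma integral_normc_cpoly (R : realType) (n : nat) (q : {poly R}) :
  (size q <= n)%N ->
  (\int[lebesgue_measure]_(t in `[0%R, (2 * pi)%R])
     (ComplexField.Normc.normc (cpoly_eval q (expi t)) ^+ 2)%:E)%E =
  (2 * pi * \sum_(i < n) q`_i ^+ 2)%:E.
Proof.
move=> sq.
(* The terms of the primitive are chosen by the equality of the indices, the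
   sine formula dividing by their difference. *)
pose prim (i j : nat) (t : R) : R :=
  if i == j then t else (i%:R - j%:R)^-1 * sin ((i%:R - j%:R) * t).
have dprim i j t : is_derive t (1 : R) (prim i j) (cos ((i%:R - j%:R) * t)).
  rewrite /prim; case: eqP => [->|/eqP ij].
    by rewrite subrr mul0r cos0; exact: is_derive_id.
  have ij0 : i%:R - j%:R != 0 :> R by rewrite subr_eq0 eqr_nat.
  set m := i%:R - j%:R in ij0 *.
  have dm : is_derive t (1 : R) (fun t : R => m * t) m.
    have := is_deriveZ m (is_derive_id t (1 : R)).
    by rewrite [m *: 1]mulr1.
  have := is_deriveZ m^-1 (is_derive1_comp (is_derive_sin (m * t)) dm).
  by rewrite [_ *: (_ * _)]mulrCA mulVf // mulr1.
pose F : R -> R :=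
  \sum_(i < n) \sum_(j < n) ((q`_i * q`_j) *: prim i j).
have dF (t : R) : is_derive t (1 : R) F
    (ComplexField.Normc.normc (cpoly_eval q (expi t)) ^+ 2).
  rewrite (@normc_cpoly_eval_expi _ n) //.
  by apply: is_derive_sum => i; apply: is_derive_sum => j.
have cF : continuous F.
  move=> t; apply: differentiable_continuous; apply/derivable1_diffP.
  exact: ex_derive.
have pi2 : 0 < 2 * pi :> R by rewrite mulr_gt0 // pi_gt0.
rewrite (@continuous_FTC2 _ _ F) //.
- have FE t : F t = \sum_(i < n) \sum_(j < n) q`_i * q`_j * prim i j t.
    by rewrite /F fct_sumE; apply: eq_bigr => i _; rewrite fct_sumE.
  rewrite -EFinB; congr EFin; rewrite !FE -sumrB mulr_sumr.
  apply: eq_bigr => i _; rewrite -sumrB (bigD1 i) //= big1 => [|j ji].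
    by rewrite /prim eqxx addr0 mulr0 subr0 mulrC expr2.
  rewrite /prim -val_eqE eq_sym in ji *; rewrite (negPf ji).
  by rewrite sin_2pi_int !mulr0 sin0 !mulr0 subrr.
- by apply: continuous_subspaceT; exact: continuous_normc_cpoly.
- split; first by move=> t _; exact: ex_derive.
    by apply: cvg_at_right_filter; exact: cF.
  by apply: cvg_at_left_filter; exact: cF.
- by move=> t _; rewrite derive1E; exact: derive_val.
Qed.

(** * Square integrals of polynomials *)

Lemma Rintegral_sum d (T : measurableType d) (R : realType)
    (mu : {measure set T -> \bar R}) (n : nat) (f : 'I_n -> T -> R) :
  (forall i, mu.-integrable setT (EFin \o f i)) ->
  \int[mu]_x (\sum_i f i x) = \sum_i \int[mu]_x f i x.
Proof.
elim: n f => [|n IHn] f intf.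
  by under eq_Rintegral do rewrite big_ord0; rewrite big_ord0 /Rintegral integral0.
rewrite big_ord_recr -IHn //= -RintegralD //.
  by apply: eq_Rintegral => x _; rewrite big_ord_recr.
rewrite (_ : _ \o _ = fun x => \sum_(i < n)
  (EFin \o f (widen_ord (leqnSn n) i)) x)%E.
  exact: integrable_sum.
by apply/funext => x /=; rewrite sumEFin.
Qed.

(** A square integral is the quadratic form of a Gram matrix.  This is used with
    two families: the Gram matrix of the monomials is the Hankel matrix, that of
    the orthonormal polynomials is the identity. *)
Lemma Rintegral_sqr_sum d (T : measurableType d) (R : realType)
    (mu : {measure set T -> \bar R}) (n : nat) (c : 'I_n -> R)
    (f : 'I_n -> T -> R) :
  (forall i j, mu.-integrable setT (EFin \o (f i \* f j))) ->
  \int[mu]_x ((\sum_i c i * f i x) ^+ 2) =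
  \sum_i \sum_j c i * c j * \int[mu]_x (f i x * f j x).
Proof.
move=> intf.
have intcf i j :
    mu.-integrable setT (EFin \o (fun x => c i * c j * (f i x * f j x))).
  exact: (integrableZl _ _ (intf i j)).
transitivity (\int[mu]_x \sum_i \sum_j c i * c j * (f i x * f j x)).
  apply: eq_Rintegral => x _; rewrite expr2 mulr_suml; apply: eq_bigr => i _.
  by rewrite mulr_sumr; apply: eq_bigr => j _; ring.
rewrite Rintegral_sum => [|i].
  apply: eq_bigr => i _; rewrite Rintegral_sum //; apply: eq_bigr => j _.
  by rewrite RintegralZl //; exact: intf.
rewrite (_ : _ \o _ = fun x =>
  (\sum_j (c i * c j * (f i x * f j x))%R%:E)%E).
  by apply: integrable_sum => // j _; exact: intcf.
by apply/funext => x /=; rewrite sumEFin.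
Qed.

Lemma integrable_horner (R : realType) (mu : borel_measure R) (q : {poly R}) :
  finite_moments mu -> mu.-integrable setT (fun x : R => q.[x]%:E).
Proof.
move=> mom.
rewrite (_ : (fun x : R => _) =
  fun x : R => (\sum_(i < size q) (q`_i)%:E * (x ^+ i)%:E)%E).
  by apply: integrable_sum => // i _; apply: integrableZl => //; exact: mom.
apply/funext => x; rewrite horner_coef -sumEFin.
by apply: eq_bigr => i _; rewrite EFinM.
Qed.

Lemma hankel_form (R : realType) (mu : borel_measure R) (N : nat)
    (q : {poly R}) : finite_moments mu -> (size q <= N.+1)%N ->
  \int[mu]_x (q.[x] ^+ 2) =
  \sum_(i < N.+1) \sum_(j < N.+1) q`_i * q`_j * hankel (moment mu) N i j.
Proof.
move=> mom sq; under eq_Rintegral do rewrite (horner_coef_wide _ sq).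
rewrite (@Rintegral_sqr_sum _ _ _ mu N.+1 (fun i => q`_i)
  (fun (i : 'I_N.+1) (x : R) => x ^+ i)) => [|i j].
  apply: eq_bigr => i _; apply: eq_bigr => j _; rewrite mxE.
  by congr (_ * _); apply: eq_Rintegral => x _; rewrite exprD.
rewrite (_ : _ \o _ = fun x : R => (x ^+ (i + j))%:E); first exact: mom.
by apply/funext => x /=; rewrite exprD.
Qed.

Lemma orthonormal_sqr_integral (R : realType) (mu : borel_measure R)
    (p : nat -> {poly R}) (n : nat) (c : nat -> R) :
  finite_moments mu -> orthonormal_polynomials mu p ->
  \int[mu]_x ((\sum_(i < n) c i *: p i).[x] ^+ 2) = \sum_(i < n) c i ^+ 2.
Proof.
move=> mom [_ _ orth].
under eq_Rintegral => x _.
  rewrite horner_sum; under eq_bigr do rewrite hornerZ.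
  over.
rewrite (@Rintegral_sqr_sum _ _ _ mu n (fun i => c i)
  (fun (i : 'I_n) x => (p i).[x])) => [|i j].
  apply: eq_bigr => i _; rewrite (bigD1 i) //= big1 => [|j ji].
    by rewrite orth eqxx mulr1 addr0.
  by rewrite orth eq_sym val_eqE (negPf ji) mulr0.
rewrite (_ : _ \o _ = fun x : R => (p i * p j).[x]%:E).
  exact: integrable_horner.
by apply/funext => x /=; rewrite hornerM.
Qed.

(** * Comparison of the two norms and the eigenvalue bound *)

(** The left side is the mean of the square modulus of [q] on the circle.
    Pointwise, Cauchy-Schwarz bounds that square modulus by the sum of the
    squares [c i ^+ 2] times a partial sum of the series defining [1 / rho],
    hence times the whole series. *)
Lemma coef_sqr_le (R : realType) (p : nat -> {poly R}) (n : nat)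
    (c : nat -> R) (q : {poly R}) :
  q = \sum_(i < n) c i *: p i -> (size q <= n)%N ->
  ((\sum_(i < n) q`_i ^+ 2)%:E <=
   (\sum_(i < n) c i ^+ 2)%:E *
   \int[lebesgue_measure]_(t in `[0%R, (2 * pi)%R])
      ((rho p (expi t))^-1 * ((2 * pi)^-1)%:E))%E.
Proof.
move=> qE sq.
have pi2 : 0 < 2 * pi :> R by rewrite mulr_gt0 // pi_gt0.
pose nrm (r : {poly R}) (t : R) : R :=
  ComplexField.Normc.normc (cpoly_eval r (expi t)) ^+ 2.
have mnrm r : measurable_fun `[0, 2 * pi] (fun t : R => (nrm r t)%:E).
  apply/measurable_EFinP; apply: measurable_funTS.
  apply: continuous_measurable_fun; exact: continuous_normc_cpoly.
(* Inversion of extended reals is involutive, [0] and [+oo] being exchanged, so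
   this holds even where the series diverges. *)
have rhoE t : ((rho p (expi t))^-1 = \sum_(0 <= k <oo) (nrm (p k) t)%:E)%E.
  by rewrite inveK.
have nrm0 r t : (0 <= (nrm r t)%:E)%E by rewrite lee_fin sqr_ge0.
have ser0 t : (0 <= \sum_(0 <= k <oo) (nrm (p k) t)%:E)%E.
  by apply: nneseries_ge0 => k _ _.
have mser : measurable_fun `[0, 2 * pi]
    (fun t : R => \sum_(0 <= k <oo) (nrm (p k) t)%:E)%E.
  exact: (@ge0_emeasurable_sum _ _ _ _ (fun k t => (nrm (p k) t)%:E) xpredT).
under eq_integral do rewrite rhoE muleC.
rewrite -ge0_integralZl_EFin //; last 3 first.
- by move=> t _; rewrite mule_ge0 // lee_fin invr_ge0 ltW.
- exact: measurable_funeM.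
- by apply: sumr_ge0 => i _; exact: sqr_ge0.
have -> : ((\sum_(i < n) q`_i ^+ 2)%:E =
    \int[lebesgue_measure]_(t in `[0%R, (2 * pi)%R])
      (((2 * pi)^-1)%:E * (nrm q t)%:E))%E.
  rewrite ge0_integralZl_EFin ?invr_ge0 ?ltW //; last exact: mnrm.
  by rewrite (integral_normc_cpoly _ _ _ sq) -EFinM mulKf // gt_eqF.
apply: ge0_le_integral => //.
- by move=> t _; rewrite mule_ge0 // lee_fin invr_ge0 ltW.
- by apply: measurable_funeM; exact: mnrm.
- by do 2 apply: measurable_funeM.
move=> t _; rewrite muleCA lee_pmul2l ?lte_fin ?invr_gt0 //.
apply: (@le_trans _ _
  ((\sum_(i < n) c i ^+ 2)%:E * \sum_(0 <= k < n) (nrm (p k) t)%:E)%E).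
  rewrite sumEFin -EFinM lee_fin big_mkord /nrm qE cpoly_eval_sum.
  exact: normc_sum_scale_le.
rewrite lee_wpmul2l ?lee_fin //; first by apply: sumr_ge0 => i _; exact: sqr_ge0.
exact: nneseries_lim_ge.
Qed.

Theorem theorem1p2 (R : realType) (alpha : borel_measure R)
    (alpha_support : infinite_set (measure_support alpha))
    (alpha_moments : finite_moments alpha)
    (alpha_indeterminate : indeterminate alpha)
    (p : nat -> {poly R}) (p_orthonormal : orthonormal_polynomials alpha p)
    (N : nat) (lambda : R)
    (lambda_smallest : smallest_eigenvalue (hankel (moment alpha) N) lambda) :
  (circle_harmonic_mean (rho p) <= lambda%:E)%E.
Proof.
have [/eigenvalueP[v vH v_neq0] _] := lambda_smallest.
pose q := \poly_(i < N.+1) v 0 (inord i).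
have qv (i : 'I_N.+1) : q`_i = v 0 i by rewrite coef_poly ltn_ord inord_val.
have sq : (size q <= N.+1)%N by exact: size_poly.
have [size_p _ _] := p_orthonormal.
have [c qE] := poly_span _ _ size_p _ _ sq.
pose V := \sum_(i < N.+1) q`_i ^+ 2.
have V_gt0 : 0 < V.
  have /rV0Pn[i vi] := v_neq0.
  rewrite /V (bigD1 i) //= ltr_pwDl //.
    by rewrite qv exprn_even_gt0.
  by apply: sumr_ge0 => j _; exact: sqr_ge0.
have form : \sum_(i < N.+1) c i ^+ 2 = lambda * V.
  rewrite -(orthonormal_sqr_integral _ _ _ _ _ alpha_moments p_orthonormal) -qE.
  rewrite (hankel_form _ _ _ _ alpha_moments sq) exchange_big mulr_sumr.
  apply: eq_bigr => j _ /=.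
  have /rowP/(_ j) := vH; rewrite !mxE qv => vHj.
  rewrite expr2 mulrA -vHj mulr_suml; apply: eq_bigr => i _.
  by rewrite qv mulrAC.
have := coef_sqr_le _ _ _ _ _ qE sq.
rewrite /circle_harmonic_mean form -/V.
set J := (\int[_]_(_ in _) _)%E.
have J_ge0 : (0 <= J)%E.
  apply: integral_ge0 => t _; apply: mule_ge0.
    by rewrite inveK; apply: nneseries_ge0 => k _ _; rewrite lee_fin sqr_ge0.
  by rewrite lee_fin invr_ge0 mulr_ge0 // pi_ge0.
have lambda_ge0 : 0 <= lambda.
  rewrite -(pmulr_lge0 _ V_gt0) -form.
  by apply: sumr_ge0 => i _; exact: sqr_ge0.
(* An infinite integral has inverse [0], and [lambda_ge0] concludes. *)
case: J J_ge0 => [r| |] //.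
rewrite lee_fin => r_ge0; rewrite -EFinM lee_fin -[leLHS]mul1r mulrAC.
rewrite ler_pM2r // => lr.
have r_gt0 : 0 < r.
  rewrite lt_neqAle r_ge0 andbT eq_sym.
  by apply: contraTneq lr => ->; rewrite mulr0 ler10.
by rewrite inver gt_eqF // lee_fin -[leLHS]mul1r ler_pdivrMr.
Qed.
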